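(* Every (finite simple) graph with at most $7$ vertices has an outside-obstacle representation.
   Context: An obstacle is a topologically open, non-self-intersecting polygonal region in the plane (possibly unbounded). Given an obstacle $C$ and a finite set $P$ of points in general position in the complement of $C$, the visibility graph $G_C(P)$ has vertex set $P$ and an edge $pq$ exactly when $\overline{pq}\cap C=\emptyset$; its straight-line drawing is the visibility drawing. An outside-obstacle representation of a graph $G$ is a pair $(P,C)$ with $G\cong G_C(P)$ such that $C$ lies in the unbounded connected component of the complement of the visibility drawing. *)

(* Defs.v *)
From HB Require Import structures.
From mathcomp Require Import all_boot all_order all_algebra.
From mathcomp Require Import all_classical all_reals topology normedtype.
Import numFieldNormedType.Exports.
Set Implicit Arguments. Unset Strict Implicit. Unset Printing Implicit Defensive.
Import Order.TTheory GRing.Theory Num.Theory.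
Local Open Scope classical_set_scope.
Local Open Scope ring_scope.

Section Geometry.
Variable R : realType.

Notation pt := (R * R)%type.

Definition padd (p q : pt) : pt := (p.1 + q.1, p.2 + q.2).
Definition pscale (t : R) (p : pt) : pt := (t * p.1, t * p.2).
Definition psub (p q : pt) : pt := (p.1 - q.1, p.2 - q.2).
Definition cross (p q : pt) : R := p.1 * q.2 - p.2 * q.1.

Definition segment (p q : pt) : set pt :=
  [set padd (pscale (1 - t) p) (pscale t q) | t in [set t : R | 0 <= t <= 1]].

Definition ray (p d : pt) : set pt :=
  [set padd p (pscale t d) | t in [set t : R | 0 <= t]].

Definition poly_edge (v : seq pt) (i : nat) : set pt :=
  segment (nth (0, 0) v i) (nth (0, 0) v (((i.+1) %% size v)%N)).

Definition simple_polygon (v : seq pt) : Prop :=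
  [/\ (3 <= size v)%N,
      (forall i, (i < size v)%N -> nth (0,0) v i <> nth (0,0) v (((i.+1) %% size v)%N)) &
      (forall i j, (i < size v)%N -> (j < size v)%N -> i <> j ->
         if j == ((i.+1) %% size v)%N then
           poly_edge v i `&` poly_edge v j = [set nth (0,0) v j]
         else if i == ((j.+1) %% size v)%N then
           poly_edge v i `&` poly_edge v j = [set nth (0,0) v i]
         else poly_edge v i `&` poly_edge v j = set0)].

Definition polygon_curve (v : seq pt) : set pt :=
  \bigcup_(i in [set i | (i < size v)%N]) poly_edge v i.

(* a simple bi-infinite polygonal chain: ray from v_0 with direction a
   (piece 0), segments [v_(k-1), v_k] (pieces 1..n-1), ray from v_(n-1)
   with direction b (piece n), where n = size v >= 1 *)
Definition chain_piece (v : seq pt) (a b : pt) (k : nat) : set pt :=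
  if k == 0 then ray (nth (0,0) v 0) a
  else if (k < size v)%N then segment (nth (0,0) v k.-1) (nth (0,0) v k)
  else ray (nth (0,0) v (size v).-1) b.

Definition simple_chain (v : seq pt) (a b : pt) : Prop :=
  [/\ (1 <= size v)%N, a <> (0,0), b <> (0,0),
      (forall k, (k.+1 < size v)%N -> nth (0,0) v k <> nth (0,0) v k.+1) &
      (forall i j, (i < j)%N -> (j <= size v)%N ->
         if j == i.+1 then
           chain_piece v a b i `&` chain_piece v a b j = [set nth (0,0) v i]
         else chain_piece v a b i `&` chain_piece v a b j = set0)].

Definition chain_curve (v : seq pt) (a b : pt) : set pt :=
  \bigcup_(k in [set k | (k <= size v)%N]) chain_piece v a b k.

(* An obstacle: a (topologically open, non-self-intersecting, possibly
   unbounded) polygonal region, i.e. a connected component of the complement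
   of a simple closed polygon or of a simple bi-infinite polygonal chain. *)
Definition obstacle (C : set pt) : Prop :=
  (exists v : seq pt, simple_polygon v /\
     exists x, ~ polygon_curve v x /\ C = connected_component (~` polygon_curve v) x)
  \/
  (exists (v : seq pt) (a b : pt), simple_chain v a b /\
     exists x, ~ chain_curve v a b x /\ C = connected_component (~` chain_curve v a b) x).

Definition bounded_pts (A : set pt) : Prop :=
  exists M : R, forall z, A z -> `|z.1| <= M /\ `|z.2| <= M.

Definition general_position (T : finType) (f : T -> pt) : Prop :=
  forall x y z : T, x <> y -> y <> z -> x <> z ->
    cross (psub (f y) (f x)) (psub (f z) (f x)) <> 0.

Definition drawing (T : finType) (e : rel T) (f : T -> pt) : set pt :=
  range f `|` \bigcup_(uv in [set uv : T * T | e uv.1 uv.2])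
                 segment (f uv.1) (f uv.2).

Definition outside_obstacle_rep (T : finType) (e : rel T)
    (f : T -> pt) (C : set pt) : Prop :=
  obstacle C /\
      injective f /\
      general_position f /\
      (forall x, ~ C (f x)) /\
      (forall x y, x <> y -> (e x y <-> segment (f x) (f y) `&` C = set0)) /\
      (exists z, ~ drawing e f z /\
        C `<=` connected_component (~` drawing e f) z /\
        ~ bounded_pts (connected_component (~` drawing e f) z)).

End Geometry.

(* Main.v *)
Require Import Defs.
From HB Require Import structures.
From mathcomp Require Import all_boot all_order all_algebra.
From mathcomp Require Import all_classical all_reals topology normedtype.
From mathcomp Require Import ring lra.
Import numFieldNormedType.Exports.
Import Order.TTheory GRing.Theory Num.Theory.
Set Implicit Arguments. Unset Strict Implicit. Unset Printing Implicit Defensive.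

(* One set of seven points, with abscissae 1, 3, 5, 7, 9, 12, 14, represents all
   graphs on seven vertices (and, dropping vertices, all smaller ones): the
   vertices can always be placed on it so that each nonedge is, over some integer
   abscissa, strictly above all the edges or strictly below all of them.  The
   obstacle is then the exterior of an x-monotone strip, unbounded to the right,
   whose upper and lower boundaries are piecewise linear with breakpoints over
   the integers: they enclose all the edges but leave out a point of each
   nonedge.  That a suitable placement exists is checked by computation, on
   graphs built by repeatedly adding a vertex of maximal degree, which up to
   isomorphism exhausts all graphs. *)

(** * Small graphs up to isomorphism *)

(* A graph on {0, ..., n-1} is stored as n rows; row j lists the adjacencies
   of j with the vertices i < j. *)
Definition rows (n : nat) (a : rel nat) : seq (seq bool) :=
  [seq [seq a i j | i <- iota 0 j] | j <- iota 0 n].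

(** On the diagonal, row [i] has length [i], so the lookup falls back to the default [false]. *)
Definition adj (g : seq (seq bool)) : rel nat := fun i j =>
  if i < j then nth false (nth [::] g j) i else nth false (nth [::] g i) j.

Definition relabel (p : seq nat) g :=
  rows (size p) (fun i j => adj g (nth 0 p i) (nth 0 p j)).

Definition deg g i := count (adj g i) (iota 0 (size g)).

(** Every graph arises from a smaller one by adding a vertex of maximal degree, so extensions
    failing this test can be discarded. *)
Definition last_has_max_deg g :=
  all (fun i => deg g i <= deg g (size g).-1) (iota 0 (size g)).

Fixpoint bitseqs (n : nat) : seq (seq bool) :=
  if n is m.+1 then [seq b :: l | b <- [:: true; false], l <- bitseqs m]
  else [:: [::]].

Definition extend (G : seq (seq (seq bool))) :=
  [seq g <- [seq rcons g s | g <- G, s <- bitseqs (size g)] | last_has_max_deg g].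

Definition reduce (P : seq (seq nat)) (G : seq (seq (seq bool))) :=
  foldr (fun g acc => if has (fun p => relabel p g \in acc) P then acc else g :: acc)
    [::] G.

Fixpoint reps (n : nat) : seq (seq (seq bool)) :=
  if n is m.+1 then reduce (permutations (iota 0 n)) (extend (reps m)) else [:: [::]].

Definition restrict (e : rel nat) (p : seq nat) : rel nat :=
  fun i j => e (nth 0 p i) (nth 0 p j).

(** The vertices form an arbitrary duplicate-free list [s], so that induction can delete a vertex
    without renaming the others. *)
Definition exhausts (G : seq (seq (seq bool))) (n : nat) :=
  forall (e : rel nat) (s : seq nat), symmetric e -> irreflexive e ->
    uniq s -> size s = n ->
    exists2 p, perm_eq p s & rows n (restrict e p) \in G.

Lemma size_rows n a : size (rows n a) = n.
Proof. by rewrite size_map size_iota. Qed.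

Lemma eq_rows n (a b : rel nat) :
  (forall i j, i < j -> j < n -> a i j = b i j) -> rows n a = rows n b.
Proof.
move=> ab; apply/eq_in_map => j; rewrite mem_iota /= add0n => jn.
by apply/eq_in_map => i; rewrite mem_iota /= add0n => ij; exact: ab.
Qed.

Lemma adj_rows n (a : rel nat) i j : symmetric a -> irreflexive a ->
  i < n -> j < n -> adj (rows n a) i j = a i j.
Proof.
move=> a_sym a_irr; have lt_case k l : k < l -> l < n ->
    nth false (nth [::] (rows n a) l) k = a k l.
  by move=> kl ln; rewrite (nth_map 0) ?size_iota// (nth_map 0) ?size_iota ?nth_iota.
move=> i_n j_n; rewrite /adj; case: ltngtP => [ij|ji|->]; first exact: lt_case.
  by rewrite lt_case // a_sym.
by rewrite (nth_map 0) ?size_iota// nth_default ?a_irr// size_map size_iota nth_iota.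
Qed.

Lemma rows_rcons n (a : rel nat) :
  rows n.+1 a = rcons (rows n a) [seq a i n | i <- iota 0 n].
Proof. by rewrite /rows -addn1 iotaD map_cat cats1. Qed.

Lemma mem_bitseqs s : s \in bitseqs (size s).
Proof.
by elim: s => //= b s IH; rewrite !mem_cat; case: b; rewrite map_f ?orbT.
Qed.

Lemma restrict_sym e p : symmetric e -> symmetric (restrict e p).
Proof. by move=> e_sym i j; rewrite /restrict e_sym. Qed.

Lemma restrict_irr e p : irreflexive e -> irreflexive (restrict e p).
Proof. by move=> e_irr i; rewrite /restrict e_irr. Qed.

Lemma restrict_map e (p q : seq nat) i j : i < size q -> j < size q ->
  restrict e [seq nth 0 p k | k <- q] i j = restrict (restrict e p) q i j.
Proof. by move=> iq jq; rewrite /restrict !(nth_map 0). Qed.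

(** Stated for total preorders, to serve for degrees and for both maxima and minima of reals. *)
Lemma exists_extremum (T : eqType) (r : rel T) (x : T) (s : seq T) :
  total r -> transitive r ->
  exists2 v, v \in x :: s & {in x :: s, forall u, r u v}.
Proof.
move=> r_total r_trans; have r_refl u : r u u by have := r_total u u; rewrite orbb.
elim: s x => [|y s IH] x; first by exists x => [|u]; rewrite inE// => /eqP->.
have [v vs vmax] := IH y; have /orP[xv|vx] := r_total x v.
  exists v => [|u]; first by rewrite inE vs orbT.
  by rewrite inE => /predU1P[->//|/vmax].
exists x => [|u]; first by rewrite inE eqxx.
by rewrite inE => /predU1P[->//|/vmax uv]; exact: r_trans vx.
Qed.

Lemma deg_rows (e : rel nat) (p : seq nat) i : symmetric e -> irreflexive e ->
  i < size p -> deg (rows (size p) (restrict e p)) i = count (e (nth 0 p i)) p.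
Proof.
move=> e_sym e_irr ip; rewrite /deg size_rows -[X in _ = count _ X](mkseq_nth 0 p) count_map.
apply: eq_in_count => j; rewrite mem_iota /= add0n => jp.
by rewrite adj_rows//; [exact: restrict_sym | exact: restrict_irr].
Qed.

(** Delete a vertex [v] of maximal degree within [s], order the others so that their encoding is in
    [G], and append [v]: this adds one row and passes the degree test. *)
Lemma exhausts_extend G n : exhausts G n -> exhausts (extend G) n.+1.
Proof.
move=> G_n e s e_sym e_irr s_uniq s_size.
case: s s_size s_uniq => [//|x s0]; set s := x :: s0 => s_size s_uniq.
have [v vs vmax] := @exists_extremum _ (fun u v => count (e u) s <= count (e v) s) x s0
  (fun u v => leq_total _ _) (fun v u w => @leq_trans _ _ _).
have [||p p_perm pG] := G_n e (rem v s) e_sym e_irr; first exact: rem_uniq.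
  by rewrite size_rem// s_size.
have p_size : size p = n by rewrite (perm_size p_perm) size_rem// s_size.
have q_perm : perm_eq (rcons p v) s.
  by rewrite perm_rcons (perm_trans _ (_ : perm_eq (v :: rem v s) s))
    ?perm_cons// perm_sym perm_to_rem.
exists (rcons p v) => //.
rewrite mem_filter; apply/andP; split; last first.
  rewrite rows_rcons; apply/allpairsPdep; eexists _, _; split; [exact: pG| |].
    by rewrite size_rows; have := mem_bitseqs [seq restrict e (rcons p v) i n | i <- iota 0 n];
       rewrite size_map size_iota; apply.
  congr rcons; apply: eq_rows => i j ij jn.
  by rewrite /restrict !nth_rcons p_size jn (ltn_trans ij jn).
have q_size : size (rcons p v) = n.+1 by rewrite size_rcons p_size.
rewrite -q_size; apply/allP => i; rewrite mem_iota add0n size_rows => /andP[_ iq].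
have last_v : nth 0 (rcons p v) (size (rcons p v)).-1 = v.
  by rewrite size_rcons nth_rcons ltnn eqxx.
rewrite !deg_rows//; last by rewrite size_rcons.
by rewrite last_v !(permP q_perm) vmax// -(perm_mem q_perm) mem_nth.
Qed.

(** If [g] is dropped, some relabelling of it by [r] is kept; composing the vertex order that
    encodes to [g] with [r] gives an order that encodes to the kept graph. *)
Lemma exhausts_reduce P G n :
  all (fun p => perm_eq p (iota 0 n)) P -> exhausts G n -> exhausts (reduce P G) n.
Proof.
move=> /allP P_perm G_n e s e_sym e_irr s_uniq s_size.
have [p p_perm] := G_n e s e_sym e_irr s_uniq s_size.
have p_size : size p = n by rewrite (perm_size p_perm).
elim: G {G_n} => [//|g G IH]; rewrite inE => /predU1P[pg|/IH{IH}[q q_perm qG]] /=.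
  case: ifPn => [/hasP[/= r rP rg]|_]; last by exists p; rewrite // pg mem_head.
  have r_perm := P_perm _ rP.
  have r_size : size r = n by rewrite (perm_size r_perm) size_iota.
  exists [seq nth 0 p k | k <- r].
    apply: perm_trans p_perm; apply: perm_trans (perm_map _ r_perm) _.
    by rewrite -p_size -/(mkseq _ _) mkseq_nth.
  have lt_r k : k < n -> nth 0 r k < n.
    by move=> kn; have := mem_nth 0 (n := k) (s := r); rewrite r_size (perm_mem r_perm) mem_iota; apply.
  rewrite (_ : rows n _ = relabel r g)// /relabel -pg r_size.
  apply: eq_rows => i j ij jn.
  have i_n := ltn_trans ij jn.
  by rewrite restrict_map ?r_size// adj_rows ?lt_r//; [exact: restrict_sym | exact: restrict_irr].
by case: ifP => _; exists q => //; rewrite inE qG orbT.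
Qed.

Lemma exhausts_reps n : exhausts (reps n) n.
Proof.
elim: n => [|n IH]; last first.
  apply: exhausts_reduce; last exact: exhausts_extend.
  by apply/allP => p; rewrite mem_permutations.
by move=> e s _ _ _ /size0nil->; exists [::].
Qed.

(** * A universal set of seven points *)

Definition abscissae := [:: 1; 3; 5; 7; 9; 12; 14].
Definition ordinates := [:: 4; 2; 1; 8; 2; 4; 5].
Definition px k := nth 0 abscissae k.
Definition py k := nth 0 ordinates k.

Definition covers (i : nat) (s : nat * nat) := px s.1 <= i <= px s.2.

(* The height of the segment s over the abscissa i is [hnum s i / hden s]. *)
Definition hnum (s : nat * nat) i := py s.1 * (px s.2 - i) + py s.2 * (i - px s.1).
Definition hden (s : nat * nat) := px s.2 - px s.1.
(** Denominators are cleared to stay within natural numbers; they are positive for segments in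
    [pairs]. *)
Definition lies_below i (s t : nat * nat) := hnum s i * hden t < hnum t i * hden s.

Definition pairs := [seq s <- [seq (a, b) | a <- iota 0 7, b <- iota 0 7] | s.1 < s.2].
(** Over these abscissae there is no vertex, so the strip has only edges to enclose. *)
Definition free_abscissae := [seq i <- iota 0 15 | i \notin abscissae].

(* The nonedge s sticks out above (or below) the drawing as soon as all the
   segments in one of these lists are nonedges. *)
Definition blockers (s : nat * nat) : seq (seq (nat * nat)) :=
  flatten [seq [:: [seq t <- pairs | covers i t && ~~ lies_below i t s];
                   [seq t <- pairs | covers i t && ~~ lies_below i s t]]
          | i <- [seq i <- free_abscissae | covers i s]].

Definition blocker_table := Eval vm_compute in [seq (s, blockers s) | s <- pairs].

Definition valid (a : rel nat) :=
  all (fun r => a r.1.1 r.1.2 || has (all (fun t => ~~ a t.1 t.2)) r.2) blocker_table.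

Lemma blocker_tableE : blocker_table = [seq (s, blockers s) | s <- pairs].
Proof. by vm_compute. Qed.

Lemma valid_nonedge (a : rel nat) s : valid a -> s \in pairs -> ~~ a s.1 s.2 ->
  exists i, [/\ i \notin abscissae, covers i s &
    (forall t, t \in pairs -> covers i t -> a t.1 t.2 -> lies_below i t s) \/
    (forall t, t \in pairs -> covers i t -> a t.1 t.2 -> lies_below i s t)].
Proof.
rewrite /valid blocker_tableE all_map => /allP valid_a s_pair s_non.
have := valid_a s s_pair; rewrite /= (negPf s_non) /= => {valid_a s_pair s_non}.
rewrite /blockers /free_abscissae.
(* The concrete lists become variables, so that simplification does not compute them. *)
move: pairs (iota 0 15) abscissae => ps is0 xs.
case/hasP => l /flattenP[/= bs /mapP[/= i]].
rewrite !mem_filter => /andP[is_ /andP[i_free _]] -> lbs /allP l_free.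
exists i; split=> //.
move: lbs; rewrite !inE => /pred2P[] l_def; [left|right] => t tp it ta;
  apply/negPn/negP => ts; have := l_free t; rewrite l_def mem_filter it ts tp ta;
  by move=> /(_ isT).
Qed.

(* Found by a greedy search; p puts the vertex [nth 0 p k] at the point k. *)
Definition placements : seq (seq nat) := [::
  [:: 1; 4; 5; 0; 6; 3; 2]; [:: 1; 2; 5; 3; 4; 6; 0]; [:: 1; 6; 5; 2; 3; 4; 0];
  [:: 0; 4; 6; 1; 5; 3; 2]; [:: 0; 3; 5; 1; 4; 6; 2]; [:: 1; 5; 4; 2; 3; 6; 0];
  [:: 2; 5; 6; 1; 4; 3; 0]; [:: 3; 2; 4; 5; 0; 6; 1]; [:: 0; 2; 4; 1; 5; 6; 3];
  [:: 4; 2; 1; 6; 0; 5; 3]; [:: 5; 6; 3; 2; 1; 4; 0]; [:: 5; 6; 3; 0; 1; 2; 4];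
  [:: 2; 6; 5; 1; 4; 3; 0]; [:: 3; 6; 4; 1; 2; 5; 0]; [:: 0; 5; 3; 2; 4; 6; 1];
  [:: 2; 5; 6; 1; 3; 4; 0]; [:: 4; 5; 0; 6; 1; 2; 3]; [:: 3; 4; 2; 5; 0; 6; 1];
  [:: 5; 6; 3; 0; 4; 1; 2]; [:: 6; 5; 0; 3; 4; 1; 2]; [:: 6; 5; 4; 1; 2; 3; 0];
  [:: 4; 0; 1; 3; 2; 6; 5]; [:: 2; 3; 4; 0; 5; 6; 1]; [:: 0; 4; 2; 6; 3; 5; 1];
  [:: 2; 6; 3; 4; 1; 5; 0]; [:: 0; 2; 5; 3; 4; 6; 1]; [:: 1; 6; 4; 2; 5; 3; 0];
  [:: 0; 6; 2; 5; 3; 4; 1]; [:: 1; 2; 4; 5; 3; 6; 0]; [:: 2; 4; 1; 6; 3; 5; 0];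
  [:: 0; 4; 5; 2; 3; 6; 1]; [:: 2; 5; 3; 4; 1; 6; 0]; [:: 3; 4; 2; 6; 0; 5; 1];
  [:: 1; 5; 3; 2; 4; 6; 0]; [:: 2; 5; 0; 4; 1; 6; 3]; [:: 4; 1; 3; 6; 0; 5; 2];
  [:: 4; 5; 3; 6; 1; 2; 0]; [:: 0; 1; 4; 2; 6; 5; 3]; [:: 4; 5; 1; 3; 0; 6; 2];
  [:: 0; 6; 3; 1; 5; 4; 2]; [:: 3; 5; 1; 6; 0; 4; 2]; [:: 0; 1; 2; 4; 5; 6; 3];
  [:: 0; 1; 2; 5; 3; 4; 6]; [:: 0; 1; 3; 2; 5; 4; 6]; [:: 0; 3; 5; 1; 6; 2; 4];
  [:: 3; 5; 6; 4; 0; 1; 2]].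

Lemma perm_placements : all (fun p => perm_eq p (iota 0 7)) placements.
Proof. by vm_compute. Qed.

Lemma placements_suffice :
  all (fun g => has (fun p => valid (fun i j => adj g (nth 0 p i) (nth 0 p j)))
                    placements) (extend (extend (reps 5))).
(* The kernel's lazy evaluation skips most of the placements, which the strict
   boolean connectives of [vm_compute] would not. *)
Proof. exact_no_check (erefl true). Qed.

Lemma mem_pairs a b : ((a, b) \in pairs) = (a < b < 7).
Proof.
rewrite mem_filter; apply/andP/andP => -[ab].
  by case/allpairsP => -[x y] [_ y7 [_ b_y]]; move: y7; rewrite -b_y mem_iota.
move=> b7; split=> //; apply/allpairsP; exists (a, b).
by rewrite !mem_iota (ltn_trans ab b7) b7.
Qed.

Lemma universal_placement (e : rel nat) : symmetric e -> irreflexive e ->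
  exists2 p, perm_eq p (iota 0 7) &
    forall s, s \in pairs -> ~~ restrict e p s.1 s.2 ->
    exists i, [/\ i \notin abscissae, covers i s &
      (forall t, t \in pairs -> covers i t -> restrict e p t.1 t.2 -> lies_below i t s) \/
      (forall t, t \in pairs -> covers i t -> restrict e p t.1 t.2 -> lies_below i s t)].
Proof.
move=> e_sym e_irr.
(* Isomorphic copies are removed only up to five vertices; the last two vertices are added without
   trying the 720 and 5040 relabellings. *)
have [p p_perm] : exists2 p, perm_eq p (iota 0 7) &
    rows 7 (restrict e p) \in extend (extend (reps 5)).
  have := exhausts_extend (exhausts_extend (@exhausts_reps 5)).
  by move=> /(_ e (iota 0 7)); apply.
move=> /(allP placements_suffice) /hasP[q q_in q_valid].
have q_perm : perm_eq q (iota 0 7) by exact: (allP perm_placements).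
have q_size : size q = 7 by rewrite (perm_size q_perm) size_iota.
have lt_q k : k < 7 -> nth 0 q k < 7.
  have := mem_nth 0 (n := k) (s := q).
  by rewrite q_size (perm_mem q_perm) mem_iota; apply.
(* The order [p] that brings the graph into the list is composed with the placement [q] of the
   listed graph. *)
exists [seq nth 0 p k | k <- q].
  have p_size : size p = 7 by rewrite (perm_size p_perm) size_iota.
  apply: perm_trans p_perm; apply: perm_trans (perm_map _ q_perm) _.
  by rewrite -p_size -/(mkseq _ _) mkseq_nth.
have restrict_q s : s \in pairs ->
    adj (rows 7 (restrict e p)) (nth 0 q s.1) (nth 0 q s.2) =
    restrict e [seq nth 0 p k | k <- q] s.1 s.2.
  case: s => a b; rewrite mem_pairs => /andP[/= ab b7].
  have a7 := ltn_trans ab b7.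
  rewrite restrict_map ?q_size// adj_rows ?lt_q//; last exact: restrict_irr.
  exact: restrict_sym.
move=> s s_pair; rewrite -restrict_q// => s_non.
have [i [i_free is_ above]] := valid_nonedge q_valid s_pair s_non.
exists i; split=> //.
by case: above => above; [left|right] => t t_pair it; rewrite -restrict_q//; exact: above.
Qed.

Lemma px_mono : {in gtn 7 &, {mono px : a b / a < b}}.
Proof.
have /allP lt7 : all (fun a => all (fun b => (px a < px b) == (a < b)) (iota 0 7)) (iota 0 7).
  by [].
move=> a b a7 b7; have := lt7 a; rewrite mem_iota => /(_ a7)/allP/(_ b).
by rewrite mem_iota => /(_ b7)/eqP.
Qed.

Lemma px_free a : a < 7 -> px a \in abscissae.
Proof. by move=> a7; rewrite mem_nth. Qed.

Lemma px_itv a : a < 7 -> 0 < px a <= 14.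
Proof. by move=> /px_free; move: (px a); apply/allP. Qed.

(** This is the nonvanishing of the orientation determinant, with its negative terms moved across to
    stay within natural numbers. *)
Lemma points_general a b c : a < 7 -> b < 7 -> c < 7 -> a != b -> b != c -> a != c ->
  px a * py b + px b * py c + px c * py a != px b * py a + px c * py b + px a * py c.
Proof.
have /allP gen : all (fun a => all (fun b => all (fun c =>
    [&& a != b, b != c & a != c] ==>
    (px a * py b + px b * py c + px c * py a != px b * py a + px c * py b + px a * py c))
    (iota 0 7)) (iota 0 7)) (iota 0 7) by vm_compute.
move=> a7 b7 c7 ab bc ac; have := gen a; rewrite mem_iota => /(_ a7)/allP/(_ b).
rewrite mem_iota => /(_ b7)/allP/(_ c).
by rewrite mem_iota ab bc ac => /(_ c7).
Qed.

(** * Piecewise linear functions *)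

Local Open Scope classical_set_scope.
Local Open Scope ring_scope.

Section PiecewiseLinear.
Variable R : realType.
Implicit Types (g h : nat -> R) (x t : R).

(** The unit ramp: a combination of its translates is continuous without any gluing of pieces. *)
Definition clamp x : R := Num.min 1 (Num.max 0 x).

Lemma clamp_le0 x : x <= 0 -> clamp x = 0.
Proof. by move=> x0; rewrite /clamp max_l// min_r. Qed.

Lemma clamp_ge1 x : 1 <= x -> clamp x = 1.
Proof. by move=> x1; rewrite /clamp max_r ?(le_trans ler01)// min_l. Qed.

Lemma clamp_id x : 0 <= x <= 1 -> clamp x = x.
Proof. by case/andP=> x0 x1; rewrite /clamp max_r// min_r. Qed.

(* Interpolates linearly the points (i, g i) for i <= N, and is constant on
   both sides of [0, N]. *)
Definition pl N g x : R := g 0 + \sum_(i < N) (g i.+1 - g i) * clamp (x - i%:R).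

Lemma clamp_continuous : continuous clamp.
Proof.
move=> x; apply: (@continuous_min R R (cst 1) (cst 0 \max id) x).
  exact: cst_continuous.
by apply: (@continuous_max R R (cst 0) id x); [exact: cst_continuous | exact: cvg_id].
Qed.

Lemma pl_continuous N g : continuous (pl N g).
Proof.
have shift_cont (a : R) : continuous (fun x : R => clamp (x - a)).
  move=> x; apply: (@continuous_comp _ _ _ (fun y => y - a) clamp).
    by apply: cvgB; [exact: cvg_id | exact: cvg_cst].
  exact: clamp_continuous.
have term_cont (i : 'I_N) :
    continuous (fun x => (g i.+1 - g i) * clamp (x - i%:R)).
  by move=> x; apply: cvgM; [exact: cvg_cst | exact: shift_cont].
move=> x; apply: cvgD; first exact: cvg_cst.
by apply: continuous_big => //; exact: add_continuous.
Qed.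

Lemma pl_recr N g x : pl N.+1 g x = pl N g x + (g N.+1 - g N) * clamp (x - N%:R).
Proof. by rewrite /pl big_ord_recr /= addrA. Qed.

Lemma pl_ge N g x : N%:R <= x -> pl N g x = g N.
Proof.
elim: N => [|N IH] Nx; first by rewrite /pl big_ord0 addr0.
rewrite pl_recr IH; last by rewrite (le_trans _ Nx)// ler_nat.
rewrite clamp_ge1; first by ring.
by rewrite lerBrDr addrC natr1.
Qed.

Lemma pl_le0 N g x : x <= 0 -> pl N g x = g 0.
Proof.
move=> x0; rewrite /pl big1 ?addr0// => i _; rewrite clamp_le0 ?mulr0//.
by rewrite subr_le0 (le_trans x0).
Qed.

(** The ramps before [i] are saturated and add up to [g i], and those after [i] vanish. *)
Lemma pl_itv N g i x : (i < N)%N -> i%:R <= x <= i.+1%:R ->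
  pl N g x = g i + (g i.+1 - g i) * (x - i%:R).
Proof.
move=> + /andP[ix xi]; elim: N => // N IH; rewrite ltnS leq_eqVlt => /predU1P[iN|iN].
  rewrite pl_recr -iN pl_ge// clamp_id// subr_ge0 ix /= lerBlDr addrC natr1//.
by rewrite pl_recr IH// clamp_le0 ?mulr0 ?addr0// subr_le0 (le_trans xi)// ler_nat.
Qed.

End PiecewiseLinear.

Lemma pl_nat (R : realType) N (g : nat -> R) i : (i <= N)%N -> pl N g i%:R = g i.
Proof.
rewrite leq_eqVlt => /predU1P[->|iN]; first by rewrite pl_ge.
by rewrite (pl_itv _ iN) ?lexx ?ler_nat ?leqnSn// subrr mulr0 addr0.
Qed.

(** * Connectedness of the two sides of a graph *)

Lemma pair_continuous (T U V : topologicalType) (f : T -> U) (g : T -> V) :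
  continuous f -> continuous g -> continuous (fun x => (f x, g x)).
Proof. by move=> f_cont g_cont x; exact: (cvg_pair (f_cont x) (g_cont x)). Qed.

(** The sign [s] selects the side above or below the graph of [u]. Each point is joined along its
    vertical open ray to [track], a vertical translate of the graph, which is connected. *)
Lemma connected_side (R : realType) (u : R -> R) (s : R) : s ^+ 2 = 1 -> continuous u ->
  connected [set z : R * R | 0 < s * (z.2 - u z.1)].
Proof.
move=> s2 u_cont; pose side := [set z : R * R | 0 < s * (z.2 - u z.1)].
pose above x := (fun r : R => (x, u x + s * r)) @` [set r | 0 < r].
pose track := (fun x : R => (x, u x + s)) @` setT.
rewrite -/side; have -> : side = \bigcup_(p in side) (above p.1 `|` track).
  apply/seteqP; split=> [z z_side|z [p p_side [[r /= r0 <-]|[x _ <-]]]].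
  - exists z => //; left; exists (s * (z.2 - u z.1)) => //.
    by rewrite mulrA -expr2 s2 mul1r addrC subrK -surjective_pairing.
  - by rewrite /side /= addrAC subrr add0r mulrA -expr2 s2 mul1r.
  - by rewrite /side /= addrAC subrr add0r -expr2 s2.
apply: bigcup_connected.
  by exists (0, u 0 + s) => p _; right; exists 0.
move=> p _; apply: connectedU.
- by exists (p.1, u p.1 + s); split; [exists 1; rewrite /= ?mulr1 | exists p.1].
- apply: connected_continuous_connected.
    by apply/connected_intervalP => x y /= x0 _ z /andP[xz _]; exact: lt_le_trans xz.
  apply/continuous_subspaceT/pair_continuous => r; first exact: cvg_cst.
  by apply: cvgD; [exact: cvg_cst | apply: cvgM; [exact: cvg_cst | exact: cvg_id]].
apply: connected_continuous_connected; first by apply/connected_intervalP.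
apply/continuous_subspaceT/pair_continuous => x; first exact: cvg_id.
by apply: cvgD; [exact: u_cont | exact: cvg_cst].
Qed.

(** Discharges the sign and range conditions left by a rewrite and leaves the main equation
    alone. *)
Ltac sides := try match goal with |- is_true _ => lra end.

(** * The exterior of a monotone strip is an obstacle *)

Section Strip.
Variables (R : realType) (N : nat) (g h : nat -> R).
Hypotheses (N_gt0 : (0 < N)%N) (g0 : g 0 = 0) (h0 : h 0 = 0).
Hypothesis ltgh : forall i, (0 < i <= N)%N -> h i < g i.
Implicit Types (x t : R) (z : R * R).

(** The term [Num.min x 0] closes the strip on the left: since [g] and [h] vanish at 0, for negative
    [x] the bounds are [x] above and [- x] below, so the strip is empty there and has its tip at the
    origin. *)
Definition upper x : R := pl N g x + Num.min x 0.
Definition lower x : R := pl N h x - Num.min x 0.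

Definition strip : set (R * R) := [set z | lower z.1 <= z.2 <= upper z.1].

(* The boundary of the strip, parametrized by the signed abscissa: negative on
   the upper half, positive on the lower half. *)
Definition boundary t : R * R := (`|t|, pl N g (- t) + pl N h t).

(** The vertices have signed abscissae from [- N] to [N], the tip being the middle one; beyond them
    the boundary consists of two horizontal rays. *)
Definition strip_chain := mkseq (fun k => boundary (k%:R - N%:R)) N.*2.+1.

Lemma lower_lt_upper x : 0 < x -> lower x < upper x.
Proof.
move=> x0; rewrite /lower /upper min_r ?ltW// subr0 addr0.
have [Nx|xN] := leP N%:R x; first by rewrite !pl_ge// ltgh// N_gt0 leqnn.
have /andP[ix xi] := truncn_itv (ltW x0); set i := Num.trunc x in ix xi.
have iN : (i < N)%N by rewrite -(ltr_nat R) (le_lt_trans ix).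
rewrite !(@pl_itv _ _ _ i)// ?ix ?ltW//.
have lt1 : h i.+1 < g i.+1 by rewrite ltgh.
(* On the first interval the bounds agree at the tip, so strictness comes from the right end and
   [0 < x]; on later intervals it holds at both ends. *)
have [i0|i_gt0] := posnP i.
  rewrite i0 g0 h0 in ix xi lt1 *; nra.
have lt0 : h i < g i by rewrite ltgh// i_gt0 ltnW.
have : i.+1%:R = i%:R + 1 :> R by rewrite natr1.
nra.
Qed.

Lemma boundary_ge0 t : 0 <= t -> boundary t = (t, lower t).
Proof.
move=> t0; rewrite /boundary ger0_norm// pl_le0 ?oppr_le0// g0 add0r.
by rewrite /lower min_r// subr0.
Qed.

Lemma boundary_le0 t : t <= 0 -> boundary t = (- t, upper (- t)).
Proof.
move=> t0; rewrite /boundary ler0_norm// (pl_le0 _ h)// h0 addr0.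
by rewrite /upper min_r ?oppr_ge0// addr0.
Qed.

(** The abscissa determines the absolute value of [t], and opposite nonzero parameters give points
    on [upper] and [lower], which differ at positive abscissae. *)
Lemma boundary_inj : injective boundary.
Proof.
have ne s t : s < 0 -> 0 < t -> boundary s <> boundary t.
  move=> s0 t0; rewrite boundary_le0 ?ltW// boundary_ge0 ?ltW// => -[-> ut].
  by have := lower_lt_upper t0; rewrite ut ltxx.
move=> s t st.
have [s0|s0] := ltP s 0; have [t0|t0] := ltP t 0.
- by move: st; rewrite !boundary_le0 ?ltW// => -[/oppr_inj].
- have := st; move: t0; rewrite le_eqVlt => /predU1P[<-|/(ne _ _ s0)//].
  by rewrite boundary_le0 ?ltW// boundary_ge0// => -[/eqP]; rewrite oppr_eq0 => /eqP.
- have := st; move: s0; rewrite le_eqVlt => /predU1P[<-|s0].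
    by rewrite boundary_ge0// boundary_le0 ?ltW// => -[/esym/eqP]; rewrite oppr_eq0 => /eqP.
  by move=> /esym/(ne _ _ t0 s0).
- by move: st; rewrite !boundary_ge0// => -[].
Qed.

Lemma lower_le_upper_ge0 x : lower x <= upper x -> 0 <= x.
Proof.
move=> le; rewrite leNgt; apply/negP => x0; move: le.
have x_le0 := ltW x0.
by rewrite /lower /upper min_l// !pl_le0// g0 h0; lra.
Qed.

(** Presents the curve as the zero set of a continuous function, as needed for an intermediate value
    argument. *)
Lemma range_boundary :
  range boundary = [set z | Num.min (upper z.1 - z.2) (z.2 - lower z.1) = 0].
Proof.
apply/seteqP; split=> [_ [t _ <-]|[x y] /=].
  have [t0|t0] := ltP t 0.
    rewrite boundary_le0 ?ltW//= subrr min_l// subr_ge0 ltW//.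
    by rewrite lower_lt_upper// oppr_gt0.
  rewrite boundary_ge0//= subrr min_r// subr_ge0.
  move: t0; rewrite le_eqVlt => /predU1P[<-|/lower_lt_upper/ltW//].
  by rewrite /lower /upper !pl_le0// g0 h0 minxx subr0 addr0.
have [le|/ltW le] := leP (upper x - y) (y - lower x) => /eqP; rewrite subr_eq0 => /eqP E.
  have x0 : 0 <= x by apply: lower_le_upper_ge0; lra.
  by exists (- x) => //; rewrite boundary_le0 ?oppr_le0// opprK E.
have x0 : 0 <= x by apply: lower_le_upper_ge0; lra.
by exists x => //; rewrite boundary_ge0// E.
Qed.

Lemma boundary_affine k t : 0 <= t <= 1 -> (k < N.*2)%N ->
  boundary (k%:R - N%:R + t) =
  padd (pscale (1 - t) (boundary (k%:R - N%:R))) (pscale t (boundary (k.+1%:R - N%:R))).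
Proof.
(* For [k < N] the piece is on the upper half, traversed from right to left: the abscissa decreases
   from [N - k] to [N - k.+1]. *)
move=> /andP[t0 t1] k2N; have [kN|Nk] := ltnP k N.
  have -> : k%:R - N%:R = - (N - k)%:R :> R by rewrite natrB ?opprB// ltnW.
  have -> : k.+1%:R - N%:R = - (N - k.+1)%:R :> R by rewrite natrB ?opprB.
  have -> : (N - k = (N - k.+1).+1)%N by rewrite subnSK.
  have : (N - k.+1 < N)%N by rewrite ltn_subrL N_gt0.
  move: (N - k.+1)%N => i iN; have iS : i.+1%:R = i%:R + 1 :> R by rewrite natr1.
  have i0 : 0 <= i%:R :> R by [].
  rewrite !boundary_le0 ?iS; sides.
  rewrite /upper !min_r; sides.
  rewrite !addr0 !opprK !(@pl_itv _ N g i)// ?iS; sides.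
  by rewrite /padd /pscale /=; congr pair; ring.
rewrite -natrB// -natrB ?(leq_trans Nk)// subSn//.
have : (k - N < N)%N by rewrite ltn_subLR// addnn.
move: (k - N)%N => i iN; have iS : i.+1%:R = i%:R + 1 :> R by rewrite natr1.
have i0 : 0 <= i%:R :> R by [].
rewrite !boundary_ge0 ?iS; sides.
rewrite /lower !min_r; sides.
rewrite !subr0 !(@pl_itv _ N h i)// ?iS; sides.
by rewrite /padd /pscale /=; congr pair; ring.
Qed.

Lemma size_strip_chain : size strip_chain = N.*2.+1.
Proof. exact: size_mkseq. Qed.

Lemma nth_strip_chain k : (k <= N.*2)%N ->
  nth (0, 0) strip_chain k = boundary (k%:R - N%:R).
Proof. by move=> kN; rewrite nth_mkseq. Qed.

(** The implications drop the left bound for the first ray and the right bound for the last, so that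
    one formula covers rays and segments. *)
Definition piece_dom k : set R :=
  [set t | ((0 < k)%N -> k%:R - 1 - N%:R <= t) /\ ((k <= N.*2)%N -> t <= k%:R - N%:R)].

Lemma natr_double : N.*2%:R - N%:R = N%:R :> R.
Proof. by rewrite -addnn natrD addrK. Qed.

Lemma chain_piece_boundary k : (k <= N.*2.+1)%N ->
  chain_piece strip_chain (1, 0) (1, 0) k = boundary @` piece_dom k.
Proof.
move=> kN; rewrite /chain_piece size_strip_chain.
have [->|k_gt0] := posnP k.
  rewrite nth_strip_chain// sub0r; have N0 : 0 <= N%:R :> R by [].
  apply/seteqP; split=> [_ [t /= t0 <-]|_ [t [_ /(_ isT) tN] <-]].
    exists (- N%:R - t); first by split=> //= _; lra.
    rewrite !boundary_le0; sides.
    rewrite /upper !min_r; sides.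
    rewrite !pl_ge; sides.
    by rewrite /padd /pscale /=; congr pair; ring.
  rewrite sub0r in tN; exists (- N%:R - t) => /=; first lra.
  rewrite !boundary_le0; sides.
  rewrite /upper !min_r; sides.
  rewrite !pl_ge; sides.
  by rewrite /padd /pscale /=; congr pair; ring.
rewrite ltnS.
have k1 : k.-1%:R = k%:R - 1 :> R by rewrite -[in RHS](prednK k_gt0) -natr1 addrK.
have [k2N|k2N] := leqP k N.*2.
  have k1N : (k.-1 < N.*2)%N by rewrite prednK.
  rewrite (nth_strip_chain k2N) (nth_strip_chain (ltnW k1N)).
  have E t : 0 <= t <= 1 -> boundary (k%:R - 1 - N%:R + t) =
     padd (pscale (1 - t) (boundary (k.-1%:R - N%:R))) (pscale t (boundary (k%:R - N%:R))).
    by move=> t01; have := boundary_affine t01 k1N; rewrite prednK// k1.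
  apply/seteqP; split=> [_ [t /= t01 <-]|_ [t [/(_ k_gt0) t0 /(_ k2N) t1] <-]].
    by rewrite -E//; exists (k%:R - 1 - N%:R + t) => //; split=> _; lra.
  exists (t - (k%:R - 1 - N%:R)) => /=; first lra.
  by rewrite -E; [congr boundary; ring | lra].
have {k2N kN k1 k_gt0} -> : k = N.*2.+1 by apply/eqP; rewrite eqn_leq kN.
rewrite nth_strip_chain//= natr_double; have N0 : 0 <= N%:R :> R by [].
have SN : N.*2.+1%:R - 1 - N%:R = N%:R :> R by rewrite -natr1 addrK natr_double.
apply/seteqP; split=> [_ [t /= t0 <-]|_ [t [/(_ isT) tN _] <-]].
  exists (N%:R + t); first by split; rewrite ?ltnn// SN => _; lra.
  rewrite !boundary_ge0; sides.
  rewrite /lower !min_r; sides.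
  rewrite !pl_ge; sides.
  by rewrite /padd /pscale /=; congr pair; ring.
rewrite SN in tN; exists (t - N%:R) => /=; first lra.
rewrite !boundary_ge0; sides.
rewrite /lower !min_r; sides.
rewrite !pl_ge; sides.
by rewrite /padd /pscale /=; congr pair; ring.
Qed.

Lemma chain_curve_boundary : chain_curve strip_chain (1, 0) (1, 0) = range boundary.
Proof.
rewrite /chain_curve size_strip_chain; apply/seteqP; split=> z.
  by case=> k /= kN; rewrite chain_piece_boundary// => -[t _ <-]; exists t.
case=> t _ <-; suff [k kN kt] : exists2 k, (k <= N.*2.+1)%N & piece_dom k t.
  by exists k => //=; rewrite chain_piece_boundary//; exists t.
have [tN|Nt] := leP t (- N%:R); first by exists 0%N => //; split=> // _; rewrite sub0r.
have tN0 : 0 <= t + N%:R by lra.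
have /andP[it ti] := truncn_itv tN0; set i := Num.trunc _ in it ti.
have [tN|Nt'] := ltP t N%:R; last first.
  exists N.*2.+1 => //; split; rewrite ?ltnn// => _.
  by rewrite -natr1 addrK natr_double.
have iN : (i < N.*2)%N by rewrite -(ltr_nat R) (le_lt_trans it)// -addnn natrD; lra.
exists i.+1; first by rewrite ltnS ltnW.
have : i.+1%:R = i%:R + 1 :> R by rewrite natr1.
by split=> _; lra.
Qed.

(** As [boundary] is injective, pieces meet exactly where their parameter intervals do: consecutive
    intervals share one endpoint, all others are disjoint. *)
Lemma simple_strip_chain : simple_chain strip_chain (1, 0) (1, 0).
Proof.
have ne10 : (1, 0) <> (0, 0) :> R * R by case=> /eqP; rewrite oner_eq0.
split=> //.
  move=> k; rewrite size_strip_chain ltnS => kN.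
  rewrite (nth_strip_chain (ltnW kN)) (nth_strip_chain kN) => /boundary_inj/eqP.
  by rewrite (inj_eq (addIr _)) eqr_nat -[k in k == _]add0n -add1n eqn_add2r.
rewrite size_strip_chain => i j ij jN.
have iN : (i <= N.*2)%N by rewrite -ltnS (leq_trans ij).
rewrite !chain_piece_boundary//; last exact: leqW.
have meet z : (boundary @` piece_dom i `&` boundary @` piece_dom j) z <->
    exists t, [/\ piece_dom i t, piece_dom j t & boundary t = z].
  split=> [[[s si <-] [t tj /boundary_inj ts]]|[t [ti tj <-]]]; last by split; exists t.
  by exists s; split=> //; rewrite -ts.
have j_gt0 : (0 < j)%N by exact: leq_trans ij.
case: eqP => [jE|/eqP j_ne].
  rewrite nth_strip_chain//; apply/seteqP; split=> z.
    move=> /meet[t [[_ /(_ iN) ti] [/(_ j_gt0) tj _] <-]] /=; congr boundary.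
    by move: tj; rewrite jE -natr1; lra.
  move=> /= ->; apply/meet; exists (i%:R - N%:R); split=> //.
    by split=> // _; lra.
  by rewrite jE; split=> _; rewrite -natr1; lra.
apply/seteqP; split=> z // /meet[t [[_ /(_ iN) ti] [/(_ j_gt0) tj _] _]].
have : (i.+2 <= j)%N by rewrite ltn_neqAle eq_sym j_ne.
by rewrite -(ler_nat R) -!natr1; lra.
Qed.

(** * The exterior as a connected component *)

Definition depth z : R := Num.min (upper z.1 - z.2) (z.2 - lower z.1).

Lemma stripE z : strip z <-> 0 <= depth z.
Proof. by rewrite /strip /depth /= le_min !subr_ge0 andbC. Qed.

Lemma upper_continuous : continuous upper.
Proof.
move=> x; apply: cvgD; first exact: pl_continuous.
by apply: (@continuous_min R R id (cst 0) x); [exact: cvg_id | exact: cst_continuous].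
Qed.

Lemma lower_continuous : continuous lower.
Proof.
move=> x; apply: cvgB; first exact: pl_continuous.
by apply: (@continuous_min R R id (cst 0) x); [exact: cvg_id | exact: cst_continuous].
Qed.

Lemma depth_continuous : continuous depth.
Proof.
have upper1 : continuous (fun z : R * R => upper z.1).
  by move=> z; apply: (@continuous_comp _ _ _ fst upper);
    [exact: cvg_fst | exact: upper_continuous].
have lower1 : continuous (fun z : R * R => lower z.1).
  by move=> z; apply: (@continuous_comp _ _ _ fst lower);
    [exact: cvg_fst | exact: lower_continuous].
move=> z; apply: (@continuous_min R _ (fun z => upper z.1 - z.2) (fun z => z.2 - lower z.1)).
  by apply: cvgB; [exact: upper1 | exact: cvg_snd].
by apply: cvgB; [exact: cvg_snd | exact: lower1].
Qed.

Lemma apex_values : upper (-1) = -1 /\ lower (-1) = 1.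
Proof.
have m1 : -1 <= 0 :> R by rewrite oppr_le0.
by rewrite /lower /upper min_l// !pl_le0// g0 h0 !add0r opprK.
Qed.

Lemma apex_outside : depth (-1, 0) < 0.
Proof.
have [up lo] := apex_values.
by rewrite /depth /= up lo gt_min; apply/orP; left; lra.
Qed.

(** The regions above [upper] and below [lower] are connected and share the point [(-1, 0)], left of
    the tip, where the two bounds are in reversed order. *)
Lemma connected_exterior : connected (~` strip).
Proof.
have -> : ~` strip = [set z | 0 < 1 * (z.2 - upper z.1)] `|`
                     [set z | 0 < -1 * (z.2 - lower z.1)].
  apply/seteqP; split=> z.
    move=> /stripE/negP; rewrite -ltNge /depth gt_min => /orP[] ?; [left|right] => /=; lra.
  by case=> /= ?; apply/stripE/negP; rewrite -ltNge /depth gt_min; apply/orP;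
    [left|right]; lra.
have [up lo] := apex_values.
apply: connectedU.
- by exists (-1, 0); split; rewrite /= ?up ?lo; lra.
- by apply: connected_side; [ring | exact: upper_continuous].
- by apply: connected_side; [ring | exact: lower_continuous].
Qed.

(** The exterior is connected and avoids the curve, which gives one inclusion. Conversely, [depth]
    is negative at [(-1, 0)]; were it nonnegative at another point of the component, it would vanish
    somewhere in it, on the curve. *)
Lemma exterior_component :
  ~` strip = connected_component (~` range boundary) (-1, 0).
Proof.
have ext_apex : (~` strip) (-1, 0) by apply/stripE/negP; rewrite -ltNge apex_outside.
apply/seteqP; split.
  apply: connected_component_max connected_exterior => // z /stripE/negP.
  by rewrite -ltNge range_boundary => + z0; rewrite /depth z0 ltxx.
set B := connected_component _ _ => b Bb /stripE b_ge0.
have B_apex : B (-1, 0).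
  apply: connected_component_refl; rewrite range_boundary => /= d0.
  by have := apex_outside; rewrite /depth d0 ltxx.
have : is_interval (depth @` B).
  apply/connected_intervalP/connected_continuous_connected; first exact: component_connected.
  exact/continuous_subspaceT/depth_continuous.
move=> /(_ (depth (-1, 0)) (depth b)) zero_depth.
have [c Bc c0] : (depth @` B) 0.
  apply: zero_depth; [by exists (-1, 0) | by exists b |].
  by rewrite b_ge0 ltW ?apex_outside.
by apply: (connected_component_sub Bc); rewrite range_boundary.
Qed.

Lemma obstacle_exterior : obstacle (~` strip).
Proof.
right; exists strip_chain, (1, 0), (1, 0); split; first exact: simple_strip_chain.
exists (-1, 0); rewrite chain_curve_boundary; split; last exact: exterior_component.
rewrite range_boundary => /= d0.
by have := apex_outside; rewrite /depth d0 ltxx.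
Qed.

Lemma strip_fst_ge0 z : strip z -> 0 <= z.1.
Proof. by move=> /andP[lz zu]; exact/lower_le_upper_ge0/(le_trans lz). Qed.

End Strip.

(** * Drawings with integer abscissae *)

(** Supplies the bounds of the strip over one abscissa: [A] holds the heights to enclose, [B] those
    to leave out when possible. By finiteness, [u] fits between the maximum of [A] and the elements
    of [B] above it, and [l] symmetrically. *)
Lemma strict_separation (R : realType) (A B : seq R) :
  exists l u, [/\ l < u, {in A, forall a, l <= a <= u} &
    {in B, forall b, {in A, forall a, a < b} \/ {in A, forall a, b < a} ->
       u < b \/ b < l}].
Proof.
have above (M : R) : exists2 u, M < u & {in B, forall b, M < b -> u < b}.
  elim: B => [|b B [u Mu uB]]; first by exists (M + 1); rewrite // ltrDl.
  have [bM|Mb] := leP b M.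
    by exists u => // c; rewrite inE => /predU1P[->|/uB//]; rewrite ltNge bM.
  exists (Num.min u ((M + b) / 2)); first by rewrite lt_min Mu; lra.
  move=> c; rewrite inE gt_min => /predU1P[-> _|cB /(uB _ cB)->//].
  by apply/orP; right; lra.
have below (M : R) : exists2 l, l < M & {in B, forall b, b < M -> b < l}.
  elim: B {above} => [|b B [l Ml lB]]; first by exists (M - 1); rewrite // ltrBlDr ltrDl.
  have [Mb|bM] := leP M b.
    by exists l => // c; rewrite inE => /predU1P[->|/lB//]; rewrite ltNge Mb.
  exists (Num.max l ((M + b) / 2)); first by rewrite gt_max Ml; lra.
  move=> c; rewrite inE lt_max => /predU1P[-> _|cB /(lB _ cB)->//].
  by apply/orP; right; lra.
case: A => [|a A].
  case: B {above below} => [|b B]; first by exists 0, 1; split.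
  have [m _ mB] := @exists_extremum R (fun x y => y <= x) b B (fun x y => le_total y x)
    (fun x y z yx zx => le_trans zx yx).
  exists (m - 2), (m - 1); split=> //; first by lra.
  by move=> c /mB mc _; left; lra.
have [M MA Mmax] := @exists_extremum R <=%R a A le_total le_trans.
have [m mA mmin] := @exists_extremum R (fun x y => y <= x) a A (fun x y => le_total y x)
    (fun x y z yx zx => le_trans zx yx).
have [u Mu uB] := above M; have [l lm lB] := below m.
exists l, u; split.
- by rewrite (lt_trans lm)// (le_lt_trans _ Mu)// Mmax.
- by move=> c cA; rewrite (le_trans (ltW lm)) ?mmin// (le_trans (Mmax _ cA))// ltW.
- move=> b bB [A_lt|lt_A]; [left; apply: uB | right; apply: lB] => //.
    exact: A_lt.
  exact: lt_A.
Qed.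

Lemma segmentC (R : realType) (p q : R * R) : segment p q = segment q p.
Proof.
suff sub (r s : R * R) : segment r s `<=` segment s r by apply/seteqP; split.
move=> _ [t /= t01 <-]; exists (1 - t) => /=; first lra.
by rewrite /padd /pscale /=; congr pair; ring.
Qed.

Section MonotoneDrawing.
Variables (R : realType) (T : finType) (e : rel T) (N : nat).
Variables (pos : T -> nat) (y : T -> R).
Hypotheses (e_sym : symmetric e) (e_irr : irreflexive e) (N_gt0 : (0 < N)%N).
Hypotheses (pos_inj : injective pos) (pos_itv : forall u, (0 < pos u <= N)%N).

Definition height u v (x : R) :=
  y u + (y v - y u) * ((x - (pos u)%:R) / ((pos v)%:R - (pos u)%:R)).

Definition place u : R * R := ((pos u)%:R, y u).

Lemma segment_height u v z : (pos u < pos v)%N ->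
  segment (place u) (place v) z <->
  (pos u)%:R <= z.1 <= (pos v)%:R /\ z.2 = height u v z.1.
Proof.
rewrite -(ltr_nat R) /place /height; move: (pos u)%:R (pos v)%:R => a b ab.
have ba0 : b - a != 0 by rewrite subr_eq0 gt_eqF.
split=> [[t /= /andP[t0 t1] <-]|]; rewrite /padd /pscale /=.
  split; first by apply/andP; split; nra.
  by field.
case: z => x w /= [axb ->]; exists ((x - a) / (b - a)) => /=.
  by rewrite divr_ge0 ?ler_pdivrMr//=; lra.
by rewrite /padd /pscale /=; congr pair; field.
Qed.

Lemma height_affine u v (x : R) i :
  height u v x = height u v i%:R +
    (height u v i.+1%:R - height u v i%:R) * (x - i%:R).
Proof. by rewrite /height -natr1; ring. Qed.

(** Lets a vertex count as a degenerate segment, so that the bounds that enclose the edges also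
    enclose the vertices. *)
Lemma height_self u x : height u u x = y u.
Proof. by rewrite /height subrr mul0r addr0. Qed.

Variables g h : nat -> R.
Hypotheses (g0 : g 0 = 0) (h0 : h 0 = 0).
Hypothesis ltgh : forall i, (0 < i <= N)%N -> h i < g i.
Hypothesis segment_bounds : forall u v i, e u v || (u == v) ->
  (pos u <= i <= pos v)%N -> h i <= height u v i%:R <= g i.

(** Between consecutive integers the segment and both bounds are affine, so comparing them at
    integers is enough. *)
Lemma height_in_strip u v x : e u v || (u == v) ->
  (pos u)%:R <= x <= (pos v)%:R -> strip N g h (x, height u v x).
Proof.
move=> uv /andP[ux xv].
have /andP[u_gt0 _] := pos_itv u; have /andP[_ vN] := pos_itv v.
have x0 : 0 <= x by rewrite (le_trans _ ux).
have /andP[ix xi] := truncn_itv x0; set i := Num.trunc x in ix xi.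
have ui : (pos u <= i)%N by rewrite -ltnS -(ltr_nat R) (le_lt_trans ux).
have iv : (i <= pos v)%N by rewrite -(ler_nat R) (le_trans ix).
rewrite /strip /lower /upper /= min_r// subr0 addr0.
have /andP[l_i u_i] : h i <= height u v i%:R <= g i by rewrite segment_bounds ?ui.
(* If the integer part of [x] is already [pos v], the segment does not reach [i.+1], but then [x] is
   the integer [i] itself. *)
have [i_eq|i_ne] := eqVneq i (pos v).
  have -> : x = i%:R by apply/eqP; rewrite eq_le ix i_eq xv.
  by rewrite !pl_nat ?i_eq// -i_eq l_i u_i.
have iv' : (i < pos v)%N by rewrite ltn_neqAle i_ne.
have /andP[l_S u_S] : h i.+1 <= height u v i.+1%:R <= g i.+1.
  by rewrite segment_bounds// iv' leqW.
have iN : (i < N)%N by exact: leq_trans vN.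
have x_itv : i%:R <= x <= i.+1%:R by rewrite ix ltW.
rewrite !(@pl_itv _ _ _ i)// (height_affine u v x i).
have t0 : 0 <= x - i%:R by rewrite subr_ge0.
have t1 : x - i%:R <= 1 by move: xi; rewrite -natr1; lra.
move: (x - i%:R) t0 t1 => t t0 t1; apply/andP; split; nra.
Qed.

Hypothesis nonedge_outside : forall u v, (pos u < pos v)%N -> ~~ e u v ->
  exists2 i, (pos u <= i <= pos v)%N &
    g i < height u v i%:R \/ height u v i%:R < h i.

Lemma edge_in_strip u v : e u v -> segment (place u) (place v) `<=` strip N g h.
Proof.
have lt_case a b : (pos a < pos b)%N -> e a b ->
    segment (place a) (place b) `<=` strip N g h.
  move=> ab eab z /(segment_height _ ab)[z1 z2].
  by rewrite (surjective_pairing z) z2; apply: height_in_strip; rewrite ?eab.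
move=> uv; case: (ltngtP (pos u) (pos v)) => [||/pos_inj uv_eq].
- by move=> /lt_case; apply.
- by move=> /lt_case; rewrite segmentC; apply; rewrite e_sym.
- by rewrite uv_eq e_irr in uv.
Qed.

Lemma nonedge_not_in_strip u v : u <> v -> ~~ e u v ->
  exists2 z, segment (place u) (place v) z & ~ strip N g h z.
Proof.
have lt_case a b : (pos a < pos b)%N -> ~~ e a b ->
    exists2 z, segment (place a) (place b) z & ~ strip N g h z.
  move=> ab eab; have [i /andP[ai ib] out] := nonedge_outside ab eab.
  exists (i%:R, height a b i%:R).
    by apply/segment_height => //=; rewrite !ler_nat ai ib.
  have iN : (i <= N)%N by rewrite (leq_trans ib)//; case/andP: (pos_itv b).
  rewrite /strip /lower /upper /= min_r// subr0 addr0 !pl_nat// => /andP[].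
  by case: out; lra.
move=> uv euv; case: (ltngtP (pos u) (pos v)) => [ab|ba|/pos_inj//].
  exact: lt_case.
by rewrite segmentC; apply: lt_case; rewrite // e_sym.
Qed.

Lemma place_in_strip u : strip N g h (place u).
Proof.
by rewrite /place -(height_self u (pos u)%:R); apply: height_in_strip; rewrite ?eqxx ?orbT ?lexx.
Qed.

(** The drawing lies in the strip, so the exterior, connected and unbounded, sits in one unbounded
    component of the complement of the drawing. *)
Lemma strip_outside_rep : general_position place ->
  outside_obstacle_rep e place (~` strip N g h).
Proof.
move=> place_gp.
have draw_strip : drawing e place `<=` strip N g h.
  move=> z [[u _ <-]|[uv /= uv_e]]; first exact: place_in_strip.
  exact: edge_in_strip.
have apex : (~` strip N g h) (-1, 0).
  by move=> /(strip_fst_ge0 g0 h0) /=; lra.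
have ext_sub : ~` strip N g h `<=` connected_component (~` drawing e place) (-1, 0).
  apply: connected_component_max => //; last exact: connected_exterior.
  exact: subsetC.
split; first exact: obstacle_exterior.
split; first by move=> u v [/eqP]; rewrite eqr_nat => /eqP/pos_inj.
split=> //; split; first by move=> u; apply; exact: place_in_strip.
split=> [u v uv|].
  split=> [euv|disj].
    by rewrite -subset0 => z [/(edge_in_strip euv)].
  apply/negPn/negP => /(nonedge_not_in_strip uv)[z zuv z_out].
  by have : (segment (place u) (place v) `&` ~` strip N g h) z by []; rewrite disj.
exists (-1, 0); split; first by move=> /draw_strip.
split=> // -[M bounded].
have far : (~` strip N g h) (- (`|M| + 1), 0).
  by move=> /(strip_fst_ge0 g0 h0) /=; have := normr_ge0 M; lra.
have [/= + _] := bounded _ (ext_sub _ far).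
by rewrite normrN ger0_norm ?addr_ge0//; have := ler_norm M; lra.
Qed.

End MonotoneDrawing.

Lemma monotone_outside_rep (R : realType) (T : finType) (e : rel T) (N : nat)
    (pos : T -> nat) (y : T -> R) :
  symmetric e -> irreflexive e -> (0 < N)%N ->
  injective pos -> (forall u, (0 < pos u <= N)%N) ->
  general_position (place pos y) ->
  (forall u v, (pos u < pos v)%N -> ~~ e u v ->
    exists i, [/\ (pos u <= i <= pos v)%N, forall w, pos w != i &
      (forall a b, e a b -> (pos a <= i <= pos b)%N ->
         height pos y a b i%:R < height pos y u v i%:R) \/
      (forall a b, e a b -> (pos a <= i <= pos b)%N ->
         height pos y u v i%:R < height pos y a b i%:R)]) ->
  exists C, outside_obstacle_rep e (place pos y) C.
Proof.
move=> e_sym e_irr N_gt0 pos_inj pos_itv place_gp visible.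
pose ht (i : nat) (p : T * T) := height pos y p.1 p.2 i%:R.
(* The heights over [i] of the edges and, as degenerate segments, of the vertices. *)
pose covering i := [seq ht i p | p <- enum {: T * T} &
  (e p.1 p.2 || (p.1 == p.2)) && (pos p.1 <= i <= pos p.2)%N].
pose heights i := [seq ht i p | p <- enum {: T * T}].
have /choice[lu lu_sep] : forall i, exists lu : R * R,
    [/\ lu.1 < lu.2, {in covering i, forall a, lu.1 <= a <= lu.2} &
      {in heights i, forall b,
        {in covering i, forall a, a < b} \/ {in covering i, forall a, b < a} ->
        lu.2 < b \/ b < lu.1}].
  by move=> i; have [l [u H]] := strict_separation (covering i) (heights i); exists (l, u).
(* At abscissa 0 both bounds are set to 0 to form the tip; all vertices lie strictly to its
   right. *)
pose g i := if i is 0 then 0 else (lu i).2.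
pose h i := if i is 0 then 0 else (lu i).1.
exists (~` strip N g h); apply: strip_outside_rep => //.
- by case=> // i _; have [] := lu_sep i.+1.
- move=> u v i uv uiv; have i_gt0 : (0 < i)%N.
    by case/andP: uiv => /(leq_trans _)-> //; case/andP: (pos_itv u).
  case: i i_gt0 uiv => // i _ uiv; have [_ + _] := lu_sep i.+1; apply.
  by apply/mapP; exists (u, v) => //; rewrite mem_filter uv uiv mem_enum.
- move=> u v uv euv; have [i [uiv i_free out]] := visible _ _ uv euv.
  exists i => //; have i_gt0 : (0 < i)%N.
    by case/andP: uiv => /(leq_trans _)-> //; case/andP: (pos_itv u).
  case: i i_gt0 uiv i_free out => // i _ uiv i_free out.
  have [_ _] := lu_sep i.+1; apply.
    by apply/mapP; exists (u, v); rewrite ?mem_enum.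
  (* As no vertex lies over [i.+1], only heights of edges occur there. *)
  have covered a : a \in covering i.+1 ->
      exists u' v', [/\ e u' v', (pos u' <= i.+1 <= pos v')%N & a = ht i.+1 (u', v')].
    case/mapP => -[a1 a2] + ->; rewrite mem_filter /= => /andP[/andP[/orP[ea|/eqP->]]].
      by move=> ai _; exists a1, a2.
    by rewrite -eqn_leq (negPf (i_free _)).
  by case: out => out; [left|right] => _ /covered[a [b [eab ab ->]]]; exact: out.
Qed.

(** * Transfer of the universal placement to arbitrary graphs *)

Lemma height_hnum (R : realType) (T : finType) (q : T -> nat) u v i :
  (q u < q v)%N -> (q v < 7)%N -> covers i (q u, q v) ->
  height (fun u => px (q u)) (fun u => (py (q u))%:R : R) u v i%:R =
  (hnum (q u, q v) i)%:R / (hden (q u, q v))%:R.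
Proof.
move=> quv qv /andP[/= ui iv]; have uv : (px (q u) < px (q v))%N.
  by rewrite px_mono// inE (ltn_trans quv).
(* Since [i] lies between the two abscissae, the truncated subtractions are exact. *)
rewrite /height /hnum /hden /= natrD !natrM !natrB ?(ltnW uv)//.
by field; rewrite subr_eq0 eqr_nat gtn_eqF.
Qed.

Local Close Scope ring_scope.
Local Close Scope classical_set_scope.

Theorem theorem2 (R : realType) (T : finType) (e : rel T) :
  symmetric e -> irreflexive e -> #|T| <= 7 ->
  exists (f : T -> (R * R)%type) (C : set (R * R)%type),
    outside_obstacle_rep e f C.
Proof.
move=> e_sym e_irr T7.
(* The graph is copied onto the ranks of its vertices; numbers below 7 that are not ranks become
   isolated vertices, whose points are simply left out of the drawing. *)
pose e7 : rel nat := fun i j =>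
  [exists u : T, [exists v : T, [&& enum_rank u == i :> nat, enum_rank v == j :> nat & e u v]]].
have e7E u v : e7 (enum_rank u) (enum_rank v) = e u v.
  apply/existsP/idP => [[a /existsP[b /and3P[/eqP/val_inj/enum_rank_inj->
    /eqP/val_inj/enum_rank_inj->]]]//|uv].
  by exists u; apply/existsP; exists v; rewrite !eqxx.
have e7_sym : symmetric e7.
  suff sub i j : e7 i j -> e7 j i by move=> i j; apply/idP/idP; apply: sub.
  move=> /existsP[a /existsP[b /and3P[ai bj ab]]].
  by apply/existsP; exists b; apply/existsP; exists a; rewrite ai bj e_sym.
have e7_irr : irreflexive e7.
  move=> i; apply/negbTE/negP => /existsP[a /existsP[b /and3P[/eqP<- /eqP/val_inj/enum_rank_inj->]]].
  by rewrite e_irr.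
have [p p_perm p_placed] := universal_placement e7_sym e7_irr.
have rank_p (u : T) : (enum_rank u : nat) \in p.
  by rewrite (perm_mem p_perm) mem_iota /= (leq_trans (ltn_ord _)).
(* Since [p] lists vertices by point, the index of a vertex in [p] is the point that it occupies. *)
pose q (u : T) := index (enum_rank u : nat) p.
have q7 u : (q u < 7).
  by have := rank_p u; rewrite -index_mem (perm_size p_perm) size_iota.
have q_inj : injective q.
  move=> u v uv; apply/enum_rank_inj/val_inj => /=.
  by rewrite -(nth_index 0 (rank_p u)) -/(q u) uv nth_index.
have q_e u v : restrict e7 p (q u) (q v) = e u v.
  by rewrite /restrict !nth_index.
pose pos u := px (q u); pose y u : R := ((py (q u))%:R)%R.
have lt_pos u v : (pos u < pos v) = (q u < q v) by rewrite /pos px_mono// inE.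
have pos_inj : injective pos.
  move=> u v uv; apply/q_inj/eqP; move: (lt_pos u v) (lt_pos v u).
  by rewrite uv ltnn; case: ltngtP.
exists (place pos y); apply: (@monotone_outside_rep R T e 14) => //.
- by move=> u; exact: px_itv.
- move=> u v w uv vw uw.
  have q_ne a b : a <> b -> q a != q b by move=> ab; apply/eqP => /q_inj.
  have := points_general (q7 u) (q7 v) (q7 w) (q_ne _ _ uv) (q_ne _ _ vw) (q_ne _ _ uw).
  rewrite -(eqr_nat R) !natrD !natrM => /eqP ne; apply: contra_not ne => E.
  move: E; rewrite /cross /psub /place /pos /y /=; lra.
- move=> u v; rewrite lt_pos => uv euv.
  have uv_pair : (q u, q v) \in pairs by rewrite mem_pairs uv /=; exact: q7.
  have [|i [i_free uvi out]] := p_placed _ uv_pair; first by rewrite q_e.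
  exists i; split=> //.
    by move=> w; apply: contraNneq i_free => <-; exact: px_free.
  have edge_pair a b : e a b -> (pos a <= i <= pos b) ->
      (q a < q b) /\ restrict e7 p (q a) (q b).
    move=> ab /andP[ai ib]; rewrite q_e -lt_pos ltn_neqAle (leq_trans ai ib) andbT.
    by split=> //; apply/eqP => /pos_inj a_b; rewrite a_b e_irr in ab.
  have hden_gt0 a b : (q a < q b) -> (0 < (hden (q a, q b))%:R :> R)%R.
    by move=> ab; rewrite ltr0n subn_gt0 lt_pos.
  have height_lt a b c d : (q a < q b) -> (q c < q d) ->
      covers i (q a, q b) -> covers i (q c, q d) ->
      lies_below i (q a, q b) (q c, q d) ->
      (height pos y a b i%:R < height pos y c d i%:R)%R.
    move=> ab cd iab icd; rewrite !height_hnum// /lies_below => lt_hnum.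
    rewrite ltr_pdivrMr ?hden_gt0// mulrAC ltr_pdivlMr ?hden_gt0//.
    by rewrite -!natrM ltr_nat.
  case: out => out; [left|right] => a b ab abi; have [qab rab] := edge_pair _ _ ab abi;
    apply: height_lt => //; apply: (out (q a, q b)) => //; rewrite mem_pairs qab; exact: q7.
Qed.
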